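(* Let $1\le k\le n$ and let $\alpha_{i,m}$, $k\le i\le m$, $k\le m\le n$, be given critical values (with $m$ standing for $|I|$) such that $\alpha_{i,m}$ is increasing in $i$ and decreasing in $m$, and such that for each given $i$ with $k\le i\le n$ the value $\alpha_{l,(n-i)+l}$ is increasing in $l$, $k\le l\le i$ (all monotonicity in the weak sense). Then: (i) The closed testing procedure with critical values $\alpha_{i,|I|}$ dominates the stepup procedure with critical values $\alpha_i:=\alpha_{k,(n-i)+k}$, $k\le i\le n$. (ii) If, furthermore, for each given $i$ with $k\le i\le n$ the values $\alpha_{l,(n-i)+l}$, $k\le l\le i$, are constant (in $l$), then these two procedures are equivalent. (iii) If for each $I\subset\{1,\dots,n\}$ with $|I|\ge k$ the local test $(I:\alpha_{i,|I|},\,k\le i\le|I|)$ is a level $\alpha$ test of $H_I$, then the stepup procedure with critical values $\alpha_{k,(n-i)+k}$, $k\le i\le n$, controls the $k$-FWER at level $\alpha$.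
   Context: Setting: $H_1,\dots,H_n$ are null hypotheses (subsets of $\Omega$, the set of all possible distributions of the data), with $p$-values $P_1,\dots,P_n$ such that $P\{P_i\le u\}\le u$ for all $u\in(0,1)$ whenever $H_i$ is true (joint dependence arbitrary). The family satisfies the free combination condition: for any $I\subseteq\{1,\dots,n\}$ there is $P\in\Omega$ for which all $H_i$, $i\in I$, are true and all $H_i$, $i\notin I$, are false. The ordered $p$-values are $P_{(1)}\le\cdots\le P_{(n)}$ with associated hypotheses $H_{(1)},\dots,H_{(n)}$; the same ordering is used by all procedures. For $I\subset\{1,\dots,n\}$ with $|I|\ge k$, $H_I=\bigcap_{i\in I}H_i$ and $P_{1:I}\le\cdots\le P_{|I|:I}$ are the ordered values of $P_i$, $i\in I$. Local test: $(I:\alpha_{i,|I|},\,k\le i\le|I|)$ rejects $H_I$ iff $P_{j:I}\le\alpha_{j,|I|}$ for at least one $j\in\{k,\dots,|I|\}$. It is level $\alpha$ if $P\big(\bigcup_{j=k}^{|I|}\{P_{j:I}\le\alpha_{j,|I|}\}\big)\le\alpha$ whenever $H_I$ is true. Closed testing procedure with critical values $\alpha_{i,|I|}$: it automatically rejects $H_{(1)},\dots,H_{(k-1)}$, and it rejects any other $H_i$ iff $H_I$ is rejected by the local test $(I:\alpha_{j,|I|},\,k\le j\le|I|)$ for all $I\subset\{1,\dots,n\}$ with $|I|\ge k$, $i\in I$ and $P_i\ge P_{k:I}$. Stepup procedure with critical values $\alpha_k\le\cdots\le\alpha_n$: if $P_{(n)}\le\alpha_n$, reject all null hypotheses; if $P_{(r)}>\alpha_r$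 for all $r\ge k$, reject $H_{(1)},\dots,H_{(k-1)}$ only; otherwise reject $H_{(1)},\dots,H_{(r)}$, where $r\ge k$ is the smallest index satisfying $P_{(n)}>\alpha_n,\dots,P_{(r+1)}>\alpha_{r+1}$. Comparison: two procedures are equivalent if they always reject (and accept) the same individual hypotheses. Procedure $A$ dominates procedure $B$ if $A$ always rejects at least those individual hypotheses rejected by $B$. $k$-FWER: if $V$ is the number of true null hypotheses that are rejected, $k\text{-FWER}=P\{V\ge k\}$; a procedure controls it at level $\alpha$ if $P\{V\ge k\}\le\alpha$ for every $P\in\Omega$. *)

(* Defs.v *)
From HB Require Import structures.
From mathcomp Require Import all_boot all_order all_algebra all_fingroup.
From mathcomp Require Import all_classical all_reals all_analysis.

Set Implicit Arguments.
Unset Strict Implicit.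
Unset Printing Implicit Defensive.

Import Order.TTheory GRing.Theory Num.Theory.
Local Open Scope ring_scope.

(* Conventions.  The n hypotheses are indexed by 'I_n (from 0), but positions
   in an ordered list of p-values and indices of critical values are natural
   numbers counted from 1.  Critical values [a i m] are only meaningful for
   k <= i <= m <= n. *)

Section Procedures.
Variables (R : realType) (n k : nat).
Implicit Types (p : 'I_n -> R) (s : 'S_n) (I : {set 'I_n}).

(* P_{j:I}, for 1 <= j <= #|I|; in particular P_(j) is [ordp p setT j]. *)
Definition ordp p I (j : nat) : R :=
  nth 0 (sort <=%R [seq p i | i <- enum I]) j.-1.

(* [s] lists the hypotheses as H_(1), ..., H_(n); ties between p-values may be
   broken arbitrarily. *)
Definition is_ordering p s :=
  forall u v : 'I_n, (u <= v)%N -> p (s u) <= p (s v).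

(* {H_(1), ..., H_(m)} *)
Definition first_hyps s (m : nat) : {set 'I_n} :=
  [set s u | u : 'I_n & (u < m)%N]%SET.

Definition local_test (a : nat -> nat -> R) p I : bool :=
  has (fun j => ordp p I j <= a j #|I|) (index_iota k #|I|.+1).

Definition closed_testing (a : nat -> nat -> R) p s : {set 'I_n} :=
  (first_hyps s k.-1 :|:
   [set i | [forall I : {set 'I_n},
      [&& (k <= #|I|)%N, i \in I & (ordp p I k <= p i)%R]
        ==> local_test a p I]])%SET.

(* The smallest r in {k, ..., n} with P_(t) > c_t for all r < t <= n; when
   k <= n the default value of [head] is not reached, since r = n qualifies. *)
Definition stepup_index (c : nat -> R) p : nat :=
  head n [seq r <- index_iota k n.+1 |
           all (fun t => c t < ordp p [set: 'I_n]%SET t)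
               (index_iota r.+1 n.+1)].

Definition stepup (c : nat -> R) p s : {set 'I_n} :=
  if ordp p [set: 'I_n]%SET n <= c n then [set: 'I_n]%SET
  else if all (fun r => c r < ordp p [set: 'I_n]%SET r) (index_iota k n.+1)
  then first_hyps s k.-1
  else first_hyps s (stepup_index c p).

End Procedures.

Local Open Scope classical_set_scope.

(* A multiple testing procedure maps the data to the set of (indices of) the
   rejected hypotheses. *)
Definition procedure (X : Type) (n : nat) := X -> {set 'I_n}.

Definition dominates (X : Type) (n : nat) (A B : procedure X n) :=
  forall x, B x \subset A x.

Definition equivalent (X : Type) (n : nat) (A B : procedure X n) :=
  forall x, A x = B x.

Section Testing.
Variables (R : realType) (d : measure_display) (X : measurableType d).
Variables (n k : nat).
Variables (Omega : set (probability X R)) (H : 'I_n -> set (probability X R)).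
Variable pv : 'I_n -> {mfun X >-> R}.

Definition pvec (x : X) : 'I_n -> R := fun i => pv i x.

Definition valid_pvalues :=
  forall (P : probability X R) (i : 'I_n), Omega P -> H i P ->
  forall u : R, 0 < u < 1 -> (P [set x | (pv i x <= u)%R] <= u%:E)%E.

Definition free_combination :=
  forall I : {set 'I_n},
  exists2 P, Omega P & forall i : 'I_n, (i \in I) <-> H i P.

Definition closed_testing_procedure (a : nat -> nat -> R) (ord : X -> 'S_n) :
  procedure X n := fun x => closed_testing k a (pvec x) (ord x).

Definition stepup_procedure (c : nat -> R) (ord : X -> 'S_n) :
  procedure X n := fun x => stepup k c (pvec x) (ord x).

Definition intersection_hyp (I : {set 'I_n}) : set (probability X R) :=
  \bigcap_(i in [set i | i \in I]) H i.

Definition local_test_level (a : nat -> nat -> R) (I : {set 'I_n})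
    (alpha : R) :=
  forall P : probability X R, Omega P -> intersection_hyp I P ->
  (P [set x | local_test k a (pvec x) I] <= alpha%:E)%E.

Definition false_rejections (A : procedure X n) (P : probability X R)
    (x : X) : nat :=
  #|[set i in A x | `[< H i P >]]%SET|.

(* A measure is a total function on sets, with unspecified values outside of
   the sigma-algebra, hence the explicit requirement that {V >= k} is an
   event. *)
Definition controls_kFWER (A : procedure X n) (alpha : R) :=
  forall P : probability X R, Omega P ->
  let E := [set x | (k <= false_rejections A P x)%N] in
  measurable E /\ (P E <= alpha%:E)%E.

End Testing.

(* Main.v *)
Require Import Defs.
From HB Require Import structures.
From mathcomp Require Import all_boot all_order all_algebra all_fingroup.
From mathcomp Require Import all_classical all_reals all_analysis.
From mathcomp Require Import zify.

Import Order.TTheory GRing.Theory Num.Theory.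
Local Open Scope ring_scope.

(** Write B(t) for the set of indices i with p_i <= t.  Every comparison
P_{j:I} <= t between an order statistic and a threshold says that I meets B(t)
in at least j elements, so both procedures can be analysed by counting, without
sorting any p-values.

Let c_r = a_{k,(n-r)+k} be the stepup critical values; they are nondecreasing
in r.  The stepup procedure rejects the first r hypotheses, where r is the last
index in {k, ..., n} with |B(c_r)| >= r (or k - 1 if there is none).  Since c is
nondecreasing, |B(c_r)| is then exactly r, so that the rejected set is B(c_r),
regardless of how ties are broken.

Domination and error control rest on one inequality.  Suppose |B(c_r)| >= r and
that I has at least k elements in B(c_r); let j be the number of these, capped
at r.  Since at most n - r indices lie outside B(c_r), |I| <= (n - r) + j, and
  c_r = a_{k,(n-r)+k} <= a_{j,(n-r)+j} <= a_{j,|I|},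
so the local test rejects H_I ([local_test_crossing]).  For (i), a hypothesis i
in B(c_r) with P_i >= P_{k:I} forces I to have k elements in B(c_r).  For (iii),
k true rejections force the set T of true hypotheses to have k elements in
B(c_r), so {V >= k} is contained in the event that the local test rejects H_T.

For (ii), let the stepup procedure stop at r and take
  I = {H_(1), ..., H_(k-1)} U {H_(r+1), ..., H_(n)}.
The values are constant along diagonals, hence a_{j,|I|} = c_u for
u = r + 1 + (j - k) > r, and fewer than u p-values are <= c_u.  Then at most
(k - 1) + (u - 1 - r) = j - 1 of them come from I, so the local test accepts
H_I, and closed testing retains every hypothesis that stepup retains. *)

(** * Order statistics as counts *)

Section Counting.
Context {R : realType} {n : nat}.
Implicit Types (p : 'I_n -> R) (s : 'S_n) (I J : {set 'I_n}).

Definition below p (t : R) : {set 'I_n} := [set i | p i <= t]%SET.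

Lemma ordp_le p I j t : (0 < j <= #|I|)%N ->
  (ordp p I j <= t) = (j <= #|I :&: below p t|)%N.
Proof.
move=> /andP[j0 jI]; rewrite /ordp.
set w := sort _ _.
have wS : sorted <=%R w by apply: sort_sorted; exact: le_total.
have sw : size w = #|I| by rewrite size_sort size_map -cardE.
have cw : count (<= t)%R w = #|I :&: below p t|.
  rewrite /w count_sort count_map cardE -size_filter /enum_mem -filter_predI.
  congr (size _); apply: eq_filter => i /=.
  by rewrite !inE andbC.
rewrite -cw; apply/idP/idP => [|jc].
  apply: contraTT; rewrite -ltnNge -ltNge => cj.
  apply: nth_count_gt => //; rewrite sw prednK// jI andbT.
  by rewrite -ltnS prednK.
by apply: nth_count_le => //; rewrite prednK.
Qed.

Lemma ordpT_le p j t : (0 < j <= n)%N ->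
  (ordp p [set: 'I_n]%SET j <= t) = (j <= #|below p t|)%N.
Proof.
by move=> jn; rewrite ordp_le ?finset.setTI// cardsT card_ord.
Qed.

Lemma below_mono p (t u : R) : t <= u -> below p t \subset below p u.
Proof. by move=> tu; apply/fintype.subsetP => i; rewrite !inE => /le_trans; apply. Qed.

Lemma card_first_hyps s m : (m <= n)%N -> #|first_hyps s m| = m.
Proof.
move=> mn; rewrite /first_hyps card_imset; last exact: perm_inj.
have wI : injective (widen_ord mn) by move=> u v /(congr1 val) /= /val_inj.
rewrite -[RHS](card_ord m) -(card_imset _ wI).
apply: eq_card => i; rewrite !inE; apply/idP/imsetP => [im|[j _ ->]] //=.
by exists (Ordinal im) => //; apply/val_inj.
Qed.

Lemma first_hypsE s m u : (s u \in first_hyps s m) = (u < m)%N.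
Proof. by rewrite mem_imset ?inE//; exact: perm_inj. Qed.

Lemma first_hyps_sub s m m' : (m <= m')%N ->
  first_hyps s m \subset first_hyps s m'.
Proof.
move=> mm'; apply/fintype.subsetP => i /imsetP[u]; rewrite inE => um ->{i}.
by rewrite first_hypsE (leq_trans um).
Qed.

Lemma first_hypsT s : first_hyps s n = [set: 'I_n]%SET.
Proof.
by apply/setP => i; rewrite -(permKV s i) first_hypsE inE ltn_ord.
Qed.

(** A sublevel set of the p-values never separates tied hypotheses, so it is an
initial segment for every admissible ordering. *)
Lemma below_first_hyps p s t : is_ordering p s ->
  below p t = first_hyps s #|below p t|.
Proof.
move=> ps; apply/esym/eqP; rewrite eqEcard card_first_hyps; last first.
  by rewrite -[leqRHS]card_ord max_card.
rewrite leqnn andbT; apply/fintype.subsetP => i /imsetP[u]; rewrite inE => um ->{i}.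
rewrite inE leNgt; apply/negP => tu.
suff /subset_leq_card : below p t \subset first_hyps s u.
  by rewrite card_first_hyps; [rewrite leqNgt um|exact/ltnW/ltn_ord].
apply/fintype.subsetP => i; rewrite -(permKV s i) first_hypsE inE => it.
rewrite ltnNge; apply/negP => /ps ui.
by move: (lt_le_trans tu (le_trans ui it)); rewrite ltxx.
Qed.

(** The three branches of the stepup procedure have a common description: it
rejects the first r hypotheses, where r is the last crossing in {k, ..., n}, or
r = k - 1 when there is no crossing. *)
Lemma stepup_spec {k c p} s : (0 < k <= n)%N ->
  exists r, [/\ (k.-1 <= r <= n)%N, stepup k c p s = first_hyps s r,
    forall u, (r < u <= n)%N -> (#|below p (c u)| < u)%N
  & (k <= r)%N -> (r <= #|below p (c r)|)%N].
Proof.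
move=> /andP[k0 kn]; rewrite /stepup.
rewrite ordpT_le; last by lia.
case: ifP => [nn|_].
  by exists n; rewrite first_hypsT; split=> // [|u]; lia.
have ordN u : (k <= u <= n)%N -> (c u < ordp p [set: 'I_n]%SET u) =
    (#|below p (c u)| < u)%N.
  by move=> un; rewrite ltNge ordpT_le ?ltnNge//; lia.
case: ifPn => [/allP none|].
  exists k.-1; split=> // [|u un|]; [lia| |lia].
  by rewrite -ordN; [apply: none; rewrite mem_index_iota; lia|lia].
rewrite -has_predC => /hasP[r0]; rewrite mem_index_iota /= => r0n cr0.
pose Q r := (k <= r <= n)%N && (r <= #|below p (c r)|)%N.
have exQ : exists r, Q r.
  by exists r0; move: cr0; rewrite /Q ordN -?leqNgt; lia.
have Qn r : Q r -> (r <= n)%N by rewrite /Q; lia.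
case: (ex_maxnP exQ Qn) => r /andP[rkn rb] rmax.
have above u : (r < u <= n)%N -> (#|below p (c u)| < u)%N.
  by move=> un; rewrite ltnNge; apply/negP => ub; have := rmax u; rewrite /Q; lia.
exists r; split=> //; first lia; congr first_hyps.
(* r is the first index at which no later crossing remains: every smaller
   index is ruled out by the crossing at r. *)
rewrite /stepup_index (_ : index_iota k n.+1 =
    (index_iota k r ++ r :: index_iota r.+1 n.+1)%SEQ); last first.
  rewrite /index_iota -[r :: _]/(iota r (n.+1 - r.+1).+1).
  have {2}-> : r = (k + (r - k))%N by lia.
  by rewrite -iotaD; congr iota; lia.
rewrite filter_cat (_ : seq.filter _ (index_iota k r) = [::]); last first.
  apply/eqP; rewrite -[_ == _]negbK -has_filter; apply/hasPn => u.
  rewrite mem_index_iota => ur; apply/allPn; exists r.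
    by rewrite mem_index_iota; lia.
  by rewrite ordN; lia.
rewrite /= ifT//; apply/allP => u; rewrite mem_index_iota => un.
by rewrite ordN; [apply: above|]; lia.
Qed.

(** One more p-value below c_r would put P_(r+1) below c_r <= c_{r+1}, that is,
make r + 1 a crossing. *)
Lemma card_below_crossing {k c p r} :
  (forall u v, (k <= u <= v)%N -> (v <= n)%N -> c u <= c v) ->
  (k <= r <= n)%N ->
  (forall u, (r < u <= n)%N -> (#|below p (c u)| < u)%N) ->
  (r <= #|below p (c r)|)%N -> #|below p (c r)| = r.
Proof.
move=> cm rn above rb; apply/eqP; rewrite eqn_leq rb andbT leqNgt.
apply/negP => rlt.
have bn : (#|below p (c r)| <= n)%N by rewrite -[leqRHS]card_ord max_card.
have := above r.+1; have /(below_mono p)/subset_leq_card : c r <= c r.+1 by apply: cm; lia.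
lia.
Qed.

(** The right-hand side ranges over all crossings rather than the last one, and
does not mention the ordering s: this is what makes {V >= k} measurable although
ties may be broken in a non-measurable way.  The last crossing has the largest
set of rejections, so it does as well as any other. *)
Lemma stepup_inter_geP {k c p s} T : (0 < k <= n)%N -> is_ordering p s ->
  (forall u v, (k <= u <= v)%N -> (v <= n)%N -> c u <= c v) ->
  (k <= #|T :&: stepup k c p s|)%N <->
  exists2 r, (k <= r <= n)%N &
    (r <= #|below p (c r)|)%N && (k <= #|T :&: below p (c r)|)%N.
Proof.
move=> kn ps cm; have [r [rn -> above cross]] := @stepup_spec k c p s kn.
have rE : (k <= r)%N -> #|below p (c r)| = r.
  by move=> kr; apply: card_below_crossing above (cross kr); [exact: cm|lia].
split=> [kT|[u un /andP[ub kT]]].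
  have kr : (k <= r)%N.
    rewrite (leq_trans kT)// -[leqRHS](card_first_hyps s); last lia.
    exact/subset_leq_card/finset.subsetIr.
  exists r; first lia.
  by rewrite (below_first_hyps p s _ ps) rE// kT card_first_hyps; lia.
have ur : (u <= r)%N.
  by rewrite leqNgt; apply/negP => ru; have := above u; lia.
have kr : (k <= r)%N by lia.
rewrite -{1}(rE kr) -below_first_hyps//; apply: (leq_trans kT).
by apply/subset_leq_card/finset.setIS/below_mono/cm; lia.
Qed.

Lemma local_testP {k a p I} : (0 < k)%N ->
  reflect (exists2 j, (k <= j <= #|I|)%N & (j <= #|I :&: below p (a j #|I|)|)%N)
    (local_test k a p I).
Proof.
move=> k0; apply: (iffP hasP) => [[j]|[j jI jb]].
  by rewrite mem_index_iota => jI; rewrite ordp_le => [jb|]; [exists j|]; lia.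
by exists j; [rewrite mem_index_iota; lia|rewrite ordp_le //; lia].
Qed.

End Counting.

(** * Closed testing against stepup *)

Section ClosedTesting.
Context {R : realType} {n k : nat} {a : nat -> nat -> R}.
Context (kn : (1 <= k <= n)%N).
Context (a_decr : forall i m m', (k <= i)%N -> (i <= m)%N -> (m <= m')%N ->
  (m' <= n)%N -> a i m' <= a i m).
Context (a_diag : forall i l l', (k <= i <= n)%N -> (k <= l)%N ->
  (l <= l')%N -> (l' <= i)%N -> a l (n - i + l)%N <= a l' (n - i + l')%N).
Implicit Types (p : 'I_n -> R) (s : 'S_n) (I : {set 'I_n}).

Let c i := a k (n - i + k)%N.

Let c_incr u v : (k <= u <= v)%N -> (v <= n)%N -> c u <= c v.
Proof. by move=> kuv vn; apply: a_decr; lia. Qed.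

(** The key inequality: few indices lie outside the sublevel set of a crossing,
so |I| exceeds the number of its elements inside by at most n - r, and climbing
the diagonal from (k, (n - r) + k) bounds c_r by a critical value of I. *)
Lemma local_test_crossing {p r I} : (k <= r <= n)%N ->
  (r <= #|below p (c r)|)%N -> (k <= #|I :&: below p (c r)|)%N ->
  local_test k a p I.
Proof.
move=> rn br; set b := #|_ :&: _| => kb.
have bI : (b <= #|I|)%N by apply/subset_leq_card/finset.subsetIl.
have In : (#|I| <= n - r + minn r b)%N.
  have IE : #|I| = (b + #|I :\: below p (c r)|)%N by rewrite cardsID.
  have := cardsC (below p (c r)); rewrite card_ord.
  have : (#|I :\: below p (c r)| <= #|~: below p (c r)|)%N.
    by apply: subset_leq_card; rewrite finset.setDE finset.subsetIr.
  have : (#|I| <= n)%N by rewrite -[leqRHS]card_ord max_card.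
  lia.
apply/local_testP; first lia.
(* The cap at r keeps the index inside the range k <= l <= r on which the
   diagonal is monotone. *)
exists (minn r b); first lia.
apply: (leq_trans (geq_minr _ _)).
apply/subset_leq_card/finset.setIS/below_mono.
apply: (le_trans (a_diag r k (minn r b) _ _ _ _)); try lia.
by apply: a_decr; lia.
Qed.

Lemma stepup_sub_closed_testing p s : is_ordering p s ->
  stepup k c p s \subset closed_testing k a p s.
Proof.
move=> ps; have [r [rn -> above cross]] := @stepup_spec _ _ k c p s kn.
have [rk|kr] := ltnP r k.
  have -> : r = k.-1 by lia.
  exact: finset.subsetUl.
have br : #|below p (c r)| = r.
  by apply: card_below_crossing above (cross kr); [exact: c_incr|lia].
rewrite -{1}br -below_first_hyps//; apply/fintype.subsetP => i; rewrite inE => ir.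
rewrite inE; apply/orP; right; rewrite inE.
apply/forallP => I; apply/implyP => /and3P[kI iI].
rewrite ordp_le; last lia.
move=> kb; apply: (@local_test_crossing p r); [lia|by rewrite br|].
by apply: (leq_trans kb); apply/subset_leq_card/finset.setIS/below_mono.
Qed.

Context (a_const : forall i l l', (k <= i <= n)%N -> (k <= l <= i)%N ->
  (k <= l' <= i)%N -> a l (n - i + l)%N = a l' (n - i + l')%N).

Lemma closed_testing_sub_stepup p s : is_ordering p s ->
  closed_testing k a p s \subset stepup k c p s.
Proof.
move=> ps; have [r [rn -> above _]] := @stepup_spec _ _ k c p s kn.
rewrite finset.subUset first_hyps_sub /=; last lia.
apply/fintype.subsetP => i; rewrite inE => /forallP irej; apply: contraT => ir.
pose I := (first_hyps s k.-1 :|: ~: first_hyps s r)%SET.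
have iI : i \in I by rewrite !inE ir orbT.
have cI : #|I| = (k.-1 + (n - r))%N.
  rewrite cardsU finset.disjoint_setI0 ?cards0.
    have := cardsC (first_hyps s r); rewrite !card_first_hyps ?card_ord; lia.
  by rewrite finset.disjoints_subset finset.setCK first_hyps_sub; lia.
have ri : i \notin first_hyps s k.-1.
  apply: contra ir; apply/fintype.subsetP/first_hyps_sub; lia.
have nr : (r < n)%N.
  rewrite ltnNge; apply/negP => nr; move: ir.
  by have -> : r = n by [lia]; rewrite first_hypsT inE.
(* The k hypotheses i, H_(1), ..., H_(k-1) all lie in I and have p-values
   at most p i. *)
have ki : (ordp p I k <= p i)%R.
  rewrite ordp_le; last lia.
  have -> : k = #|i |: first_hyps s k.-1|.
    by rewrite cardsU1 ri card_first_hyps; lia.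
  apply/subset_leq_card/fintype.subsetP => j; rewrite 3!inE => /orP[/eqP ->|jk].
    by rewrite iI inE lexx.
  rewrite [in X in X && _]inE jk /= inE.
  move: ri jk; rewrite -(permKV s i) -(permKV s j) !first_hypsE -leqNgt => ki jk.
  by apply: ps; lia.
have := irej I; rewrite iI ki !andbT cI => /implyP.
move=> /(_ ltac:(lia)) /local_testP - /(_ ltac:(lia)) [j].
rewrite cI => jI; set u := (r.+1 + (j - k))%N.
(* Along I, the j-th smallest p-value with j >= k is P_(u). *)
have -> : a j (k.-1 + (n - r))%N = c u.
  rewrite /c (a_const u k j); try lia.
  by congr (a j _); lia.
have bu : (#|below p (c u)| < u)%N by apply: above; lia.
rewrite leqNgt => /negP[].
have bI : I :&: below p (c u) \subset
    first_hyps s k.-1 :|: (first_hyps s u.-1 :\: first_hyps s r).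
  rewrite finset.setIUl; apply: finset.setUSS; first exact: finset.subsetIl.
  rewrite finset.setIC -finset.setDE finset.setSD// (below_first_hyps _ s _ ps).
  by apply: first_hyps_sub; lia.
apply: (leq_ltn_trans (subset_leq_card bI)).
apply: (leq_ltn_trans (leq_card_setU _ _)).
rewrite cardsDS; last by apply: first_hyps_sub; lia.
rewrite !card_first_hyps; lia.
Qed.

End ClosedTesting.

(** * Measurability *)

Section Measurability.
Context {R : realType} {d : measure_display} {X : measurableType d} {n : nat}.
Context (pv : 'I_n -> {mfun X >-> R}).
Local Open Scope classical_set_scope.

(** A sublevel set takes finitely many values, and each of them is attained on
a finite intersection of half-line preimages and their complements. *)
Lemma measurable_below (t : R) (Q : pred {set 'I_n}) :
  measurable [set x | Q (below (pvec pv x) t)].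
Proof.
have -> : [set x | Q (below (pvec pv x) t)] =
    \bigcup_(S in [set S : {set 'I_n} | Q S])
    \bigcap_(i in [set: 'I_n]) [set x | (pv i x <= t) = (i \in S)].
  apply/seteqP; split=> x /= => [Qx|[S QS /= xS]].
    by exists (below (pvec pv x) t) => // i _ /=; rewrite inE.
  suff -> : below (pvec pv x) t = S by [].
  by apply/setP => i; rewrite inE -xS.
apply: fin_bigcup_measurable => // S _; apply: fin_bigcap_measurable => // i _.
have mle : measurable [set x | pv i x <= t].
  rewrite -[X in measurable X]setTI.
  have -> : [set x | pv i x <= t] = pv i @^-1` `]-oo, t].
    by apply/seteqP; split=> x; rewrite /= in_itv.
  exact: measurable_funP.
case: (i \in S); first exact: mle.
suff -> : [set x | (pv i x <= t) = false] = ~` [set x | pv i x <= t].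
  exact: measurableC.
by apply/seteqP; split=> x /=; case: (pv i x <= t).
Qed.

Lemma measurable_local_test k (a : nat -> nat -> R) I : (0 < k)%N ->
  measurable [set x | local_test k a (pvec pv x) I].
Proof.
move=> k0; have -> : [set x | local_test k a (pvec pv x) I] =
    \bigcup_(j in [set j | (k <= j <= #|I|)%N])
    [set x | (j <= #|I :&: below (pvec pv x) (a j #|I|)|)%N].
  by apply/seteqP; split=> x /=; [move=> /(local_testP k0)[j ? ?]; exists j
    |move=> [j ? ?]; apply/(local_testP k0); exists j].
apply: bigcup_measurable => j _.
exact: (measurable_below _ (fun S => j <= #|I :&: S|)%N).
Qed.

Lemma measurable_stepup_inter_ge k c (ord : X -> 'S_n) (T : {set 'I_n}) :
  (0 < k <= n)%N -> (forall x, is_ordering (pvec pv x) (ord x)) ->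
  (forall u v, (k <= u <= v)%N -> (v <= n)%N -> c u <= c v) ->
  measurable [set x | (k <= #|T :&: stepup k c (pvec pv x) (ord x)|)%N].
Proof.
move=> kn ps cm.
have -> : [set x | (k <= #|T :&: stepup k c (pvec pv x) (ord x)|)%N] =
    \bigcup_(r in [set r | (k <= r <= n)%N])
    [set x | (r <= #|below (pvec pv x) (c r)|)%N &&
             (k <= #|T :&: below (pvec pv x) (c r)|)%N].
  by apply/seteqP; split=> x /= /(stepup_inter_geP T kn (ps x) cm).
apply: bigcup_measurable => r _.
exact: (measurable_below _ (fun S => (r <= #|S|)%N && (k <= #|T :&: S|)%N)).
Qed.

End Measurability.

(** * Comparison of the procedures and error control *)

Theorem theorem4p3 (R : realType) (d : measure_display) (X : measurableType d)
    (n k : nat) (Omega : set (probability X R))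
    (H : 'I_n -> set (probability X R)) (pv : 'I_n -> {mfun X >-> R})
    (ord : X -> 'S_n) (a : nat -> nat -> R) :
  (1 <= k <= n)%N ->
  (forall i, (H i `<=` Omega)%classic) ->
  valid_pvalues Omega H pv ->
  free_combination Omega H ->
  (forall x, is_ordering (pvec pv x) (ord x)) ->
  (forall i i' m, (k <= i)%N -> (i <= i')%N -> (i' <= m)%N -> (m <= n)%N ->
     a i m <= a i' m) ->
  (forall i m m', (k <= i)%N -> (i <= m)%N -> (m <= m')%N -> (m' <= n)%N ->
     a i m' <= a i m) ->
  (forall i l l', (k <= i <= n)%N -> (k <= l)%N -> (l <= l')%N -> (l' <= i)%N ->
     a l (n - i + l)%N <= a l' (n - i + l')%N) ->
  let CT := closed_testing_procedure k pv a ord in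
  let SU := stepup_procedure k pv (fun i => a k (n - i + k)%N) ord in
  [/\ dominates CT SU,
      (forall i l l', (k <= i <= n)%N -> (k <= l <= i)%N -> (k <= l' <= i)%N ->
         a l (n - i + l)%N = a l' (n - i + l')%N) ->
      equivalent CT SU
    & forall alpha : R,
      (forall I : {set 'I_n}, (k <= #|I|)%N ->
         local_test_level k Omega H pv a I alpha) ->
      controls_kFWER k Omega H SU alpha].
Proof.
move=> kn _ _ fc ps _ a_decr a_diag CT SU.
have cm u v : (k <= u <= v)%N -> (v <= n)%N ->
    a k (n - u + k)%N <= a k (n - v + k)%N.
  by move=> kuv vn; apply: a_decr; lia.
have CTSU x : SU x \subset CT x.
  exact: stepup_sub_closed_testing kn a_decr a_diag _ _ (ps x).
split=> // [a_const x|alpha lev P OP].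
  apply/eqP; rewrite finset.eqEsubset CTSU andbT.
  exact: closed_testing_sub_stepup kn a_const _ _ (ps x).
pose T : {set 'I_n} := [set i | `[< H i P >]]%SET.
have VE x : false_rejections H SU P x = #|T :&: SU x|.
  by rewrite /false_rejections; apply: eq_card => i; rewrite !inE andbC.
have mE : measurable [set x | (k <= false_rejections H SU P x)%N]%classic.
  under eq_set do rewrite VE.
  exact: measurable_stepup_inter_ge kn ps cm.
split=> //; have [kT|Tk] := leqP k #|T|; last first.
  rewrite (_ : [set x | _]%classic = set0) ?measure0; last first.
    apply/seteqP; split=> x //=; rewrite VE => kV.
    have : (#|T :&: SU x| <= #|T|)%N by apply/subset_leq_card/finset.subsetIl.
    by rewrite leqNgt (leq_trans Tk kV).
  (* With fewer than k true hypotheses V >= k is impossible, and alpha is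
     nonnegative because it bounds the probability of an event under some
     distribution: one for which all hypotheses are true. *)
  have [P' OP' P'T] := fc [set: 'I_n]%SET.
  apply: le_trans (lev [set: 'I_n]%SET _ P' OP' _).
  - exact: measure_ge0.
  - by rewrite cardsT card_ord; lia.
  - by move=> i /= iT; apply/P'T.
apply: le_trans (lev T kT P OP _); last by move=> i /=; rewrite inE => /asboolP.
apply: le_measure; rewrite ?inE//; first by apply: measurable_local_test; lia.
move=> x /=; rewrite VE => /(stepup_inter_geP T kn (ps x) cm)[r rn /andP[rb kV]].
exact: (local_test_crossing kn a_decr a_diag rn rb kV).
Qed.
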